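(* Up to isomorphism, there are exactly $2$ classes of locally equienergetic graphs of order $5$, namely: (i) $\{K_5,\ K_3\cup K_2,\ C_5\}$, with $e(K_5)=e(K_3\cup K_2)=e(C_5)$; (ii) $\{K_4\cup K_1,\ K_2\cup K_2\cup K_1\}$, with $e(K_4\cup K_1)=e(K_2\cup K_2\cup K_1)$.
   Context: For a finite simple undirected graph $G$ with vertices $v_1,\dots,v_n$, the adjacency matrix $A(G)$ has $(i,j)$ entry $1$ if $v_i,v_j$ are adjacent and $0$ otherwise. The energy $\mathscr{E}(G)$ is the sum of the absolute values of the eigenvalues of $A(G)$ (counted with multiplicity); the graph with no vertices has energy $0$. For a vertex $v$ of $G$, let $G^{v}$ be the graph obtained from $G$ by deleting $v$. The local energy of $G$ at $v$ is $\mathscr{E}_G(v)=\mathscr{E}(G)-\mathscr{E}(G^{v})$, and the local energy of $G$ is $e(G)=\sum_{v\in V(G)}\mathscr{E}_G(v)$. Two (non-isomorphic) graphs of the same order are locally equienergetic if they have the same local energy. A class of locally equienergetic graphs of order $n$ is the set of all isomorphism classes of finite simple undirected (possibly disconnected) graphs of order $n$ having a given common value of $e$, provided this set has at least two elements. $K_m$ is the complete graph and $C_m$ the cycle on $m$ vertices; $\cup$ is disjoint union. *)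

(* Defs.v *)
From HB Require Import structures.
From mathcomp Require Import all_boot all_order all_fingroup all_algebra.
From mathcomp Require Import polyrcf.

Set Implicit Arguments.
Unset Strict Implicit.
Unset Printing Implicit Defensive.

Import GRing.Theory Num.Theory.
Local Open Scope ring_scope.

(* Finite simple graphs with vertex set 'I_n, given by their boolean adjacency
   matrix.  Every graph of order n is isomorphic to one of these, so they
   account for all isomorphism classes of graphs of order n; and sgraph n is a
   finType, so sets of graphs can be formed. *)
Record sgraph (n : nat) := SGraph {
  adj :> 'M[bool]_n;
  adjP : (adj^T == adj) && [forall i, ~~ adj i i]
}.

HB.instance Definition _ n := [isSub for @adj n].
HB.instance Definition _ n := [Finite of sgraph n by <:].

Lemma adj_sym n (G : sgraph n) i j : G i j = G j i.
Proof. by case/andP: (adjP G) => /eqP/matrixP/(_ j i); rewrite mxE. Qed.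

Lemma adj_irr n (G : sgraph n) i : G i i = false.
Proof. by case/andP: (adjP G) => _ /forallP/(_ i)/negbTE. Qed.

Lemma adj_intro n (A : 'M[bool]_n) :
  (forall i j, A i j = A j i) -> (forall i, A i i = false) ->
  (A^T == A) && [forall i, ~~ A i i].
Proof.
move=> symA irrA; apply/andP; split; last by apply/forallP=> i; rewrite irrA.
by apply/eqP/matrixP=> i j; rewrite mxE.
Qed.

Fact complete_subproof n (A := \matrix_(i < n, j < n) (i != j)) :
  (A^T == A) && [forall i, ~~ A i i].
Proof. by apply: adj_intro => [i j|i]; rewrite !mxE ?eqxx // eq_sym. Qed.

Definition complete n : sgraph n := SGraph (complete_subproof n).

(* ordS is the cyclic successor i |-> i + 1 mod n; this is the cycle C_n for
   n >= 3. *)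
Fact cycle_subproof n
    (A := \matrix_(i < n, j < n) ((i != j) && ((j == ordS i) || (i == ordS j)))) :
  (A^T == A) && [forall i, ~~ A i i].
Proof.
by apply: adj_intro => [i j|i]; rewrite !mxE ?eqxx // eq_sym orbC.
Qed.

Definition cycle_graph n : sgraph n := SGraph (cycle_subproof n).

Fact disjoint_union_subproof m n (G : sgraph m) (H : sgraph n)
    (A := block_mx G (const_mx false) (const_mx false) H) :
  (A^T == A) && [forall i, ~~ A i i].
Proof.
apply: adj_intro => [i j|i]; last first.
  by case: (split_ordP i) => k ->; rewrite /A ?(block_mxEul, block_mxEdr) adj_irr.
case: (split_ordP i) => k ->; case: (split_ordP j) => l ->;
  by rewrite /A ?(block_mxEul, block_mxEur, block_mxEdl, block_mxEdr) ?mxE // adj_sym.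
Qed.

Definition disjoint_union m n (G : sgraph m) (H : sgraph n) : sgraph (m + n) :=
  SGraph (disjoint_union_subproof G H).

Fact delete_subproof n (G : sgraph n) (v : 'I_n) (A := row' v (col' v G)) :
  (A^T == A) && [forall i, ~~ A i i].
Proof.
by apply: adj_intro => [i j|i]; rewrite !mxE ?adj_irr // adj_sym.
Qed.

(* The vertices other than v are renumbered, in order, by 'I_n.-1. *)
Definition delete n (G : sgraph n) (v : 'I_n) : sgraph n.-1 :=
  SGraph (delete_subproof G v).

Definition iso n (G H : sgraph n) : bool :=
  [exists s : 'S_n, forall i, forall j, G i j == H (s i) (s j)].

Definition iso_class n (G : sgraph n) : {set sgraph n} := [set H | iso G H].

Section Energy.

Variable R : rcfType.

Definition adjmx n (G : sgraph n) : 'M[R]_n := \matrix_(i, j) (G i j)%:R.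

(* The eigenvalues are the roots of the characteristic polynomial, and mup
   gives their multiplicities; as adjmx G is symmetric, all its eigenvalues
   lie in the real closed field R.  For n = 0 the polynomial is 1 and the
   energy is 0. *)
Definition energy n (G : sgraph n) : R :=
  let p := char_poly (adjmx G) in
  \sum_(x <- rootsR p) `|x| *+ mup x p.

Definition local_energy_at n (G : sgraph n) (v : 'I_n) : R :=
  energy G - energy (delete G v).

Definition local_energy n (G : sgraph n) : R :=
  \sum_(v < n) local_energy_at G v.

Definition iso_classes_with_local_energy n (t : R) : {set {set sgraph n}} :=
  [set iso_class G | G : sgraph n & local_energy G == t].

(* A class is a set of isomorphism classes; t ranges over the values actually
   taken by the local energy, any other t giving the empty set. *)
Definition locally_equienergetic_classes n : {set {set {set sgraph n}}} :=
  [set S in [set iso_classes_with_local_energy n (local_energy G)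
              | G : sgraph n] | (1 < #|S|)%N].

End Energy.

(* Main.v *)
Require Import Defs.
From Stdlib Require Import ZArith.
From HB Require Import structures.
From mathcomp Require Import all_boot all_order all_fingroup all_algebra.
From mathcomp Require Import polyrcf ssrZ zify ring.

(**
Isomorphic graphs have similar adjacency matrices, and so do the subgraphs left
by deleting corresponding vertices; hence the local energy is an isomorphism
invariant ([iso_local_energy]). There are 34 graphs of order 5 up to
isomorphism, so the classes are known once these 34 local energies have been
compared. The comparison rests on rational enclosures of the local energies,
obtained by computation, and on the exact values of those that coincide.

The enclosures come from the characteristic polynomials, which have integer
coefficients and are computed by Laplace expansion ([char_poly_polyZ]). Each of
them is a product of monic factors with known rational brackets for their
roots: when a factor of degree d changes sign on d disjoint intervals, it has
exactly one root in each of them ([isolates_split]). Summing bounds on the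
absolute values of the roots encloses the energy of each graph, hence its local
energy ([local_box_bounds]).

An exhaustive search shows that each of the 1024 labelled graphs on five
vertices is isomorphic to one of 34 representatives ([representative]). Their
enclosures are pairwise disjoint, except inside the lists of K_4 u K_1 and
2 K_2 u K_1 on the one hand, and of K_5, K_3 u K_2 and C_5 on the other hand
([local_energy_grouped]). All graphs of these two lists have an integral
spectrum but C_5, and so do their vertex-deleted subgraphs: their enclosures are
reduced to a point and give the common values 8 and 10 of the local energy
([local_energy8], [local_energy10]). For
C_5, the golden ratio appears in the same way in its spectrum and in that of the
path on four vertices, and cancels ([local_energy_C5]).
*)

Set Implicit Arguments.
Unset Strict Implicit.
Unset Printing Implicit Defensive.

Import Order.TTheory GRing.Theory Num.Theory.
Local Open Scope ring_scope.

Delimit Scope Z_scope with BZ.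

(** * Isomorphism invariance of the local energy *)

Lemma sgraph_eq n (G H : sgraph n) : (forall i j, G i j = H i j) -> G = H.
Proof. by move=> eqGH; apply/val_inj/matrixP. Qed.

Lemma isoP n (G H : sgraph n) :
  reflect (exists s : 'S_n, forall i j, G i j = H (s i) (s j)) (iso G H).
Proof.
apply: (iffP existsP) => [[s /forallP eqGH]|[s eqGH]]; exists s.
  by move=> i j; apply/eqP/(forallP (eqGH i)).
by apply/forallP=> i; apply/forallP=> j; rewrite eqGH.
Qed.

Lemma iso_refl n : reflexive (@iso n).
Proof. by move=> G; apply/isoP; exists 1%g => i j; rewrite !perm1. Qed.

Lemma iso_sym n : symmetric (@iso n).
Proof.
move=> G H; apply/isoP/isoP => -[s eqGH]; exists s^-1%g => i j.
  by rewrite eqGH !permKV.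
by rewrite eqGH !permKV.
Qed.

Lemma iso_trans n : transitive (@iso n).
Proof.
move=> H G K /isoP[s eqGH] /isoP[t eqHK]; apply/isoP; exists (s * t)%g => i j.
by rewrite eqGH eqHK !permM.
Qed.

Lemma iso_class_eq n (G H : sgraph n) :
  (iso_class G == iso_class H) = iso G H.
Proof.
apply/eqP/idP => [/setP/(_ H)|GH].
  by rewrite !inE iso_refl.
apply/setP=> K; rewrite !inE; apply/idP/idP; apply: iso_trans => //.
by rewrite iso_sym.
Qed.

(** The bijection [s] need not preserve the renumbering of the remaining vertices:
the isomorphism [t] is what [s] becomes once both sides are renumbered. *)
Lemma iso_delete n (G H : sgraph n) (s : 'S_n) (v : 'I_n) :
  (forall i j, G i j = H (s i) (s j)) -> iso (delete G v) (delete H (s v)).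
Proof.
move=> eqGH.
have /all_sig[t tP] i : {j | s (lift v i) = lift (s v) j}.
  have: s v != s (lift v i) by rewrite (inj_eq perm_inj) neq_lift.
  by case/unlift_some=> j -> _; exists j.
have inj_t : injective t.
  by move=> i j eq_t; apply/(@lift_inj _ v)/(@perm_inj _ s); rewrite !tP eq_t.
by apply/isoP; exists (perm inj_t) => i j; rewrite !mxE !permE -!tP.
Qed.

Section Invariance.
Variable R : rcfType.

(** A relabelling conjugates the matrix by a permutation matrix, and the two
signatures cancel. *)
Lemma iso_char_poly n (G H : sgraph n) :
  iso G H -> char_poly (adjmx R G) = char_poly (adjmx R H).
Proof.
case/isoP=> s eqGH; rewrite /char_poly.
have ->: char_poly_mx (adjmx R G) =
         row_perm s (col_perm s (char_poly_mx (adjmx R H))).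
  by apply/matrixP=> i j; rewrite !mxE eqGH (inj_eq perm_inj).
rewrite row_permE col_permE !det_mulmx !det_perm odd_permV.
by rewrite mulrC -mulrA -signr_addb addbb mulr1.
Qed.

Lemma iso_energy n (G H : sgraph n) : iso G H -> energy R G = energy R H.
Proof. by rewrite /energy => /iso_char_poly->. Qed.

Lemma iso_local_energy n (G H : sgraph n) :
  iso G H -> local_energy R G = local_energy R H.
Proof.
move=> isoGH; have [s eqGH] := isoP _ _ isoGH.
rewrite /local_energy [RHS](reindex_inj (@perm_inj _ s)) /=.
apply: eq_bigr => v _; rewrite /local_energy_at (iso_energy isoGH).
by rewrite (iso_energy (iso_delete _ eqGH)).
Qed.

Lemma local_energyE n (G : sgraph n) :
  local_energy R G = energy R G *+ n - \sum_v energy R (delete G v).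
Proof. by rewrite /local_energy sumrB sumr_const card_ord. Qed.

End Invariance.

(** * The energy of a graph with a split characteristic polynomial *)

Section Split.
Variable R : rcfType.

Lemma mup_prod_XsubC (s : seq R) x :
  mup x (\prod_(y <- s) ('X - y%:P)) = count_mem x s.
Proof.
elim: s => [|y s IHs]; first by rewrite big_nil mupNroot ?root1.
rewrite big_cons mupM ?polyXsubC_eq0 ?monic_neq0 ?monic_prod_XsubC //=.
by rewrite IHs -['X - _]expr1 mup_XsubCX; case: eqP.
Qed.

(** The definition of the energy sums over distinct roots weighted by their
multiplicity; once the characteristic polynomial is split, multiplicities are
the numbers of occurrences in the list of roots. *)
Lemma energy_prod n (G : sgraph n) (s : seq R) :
  char_poly (adjmx R G) = \prod_(x <- s) ('X - x%:P) ->
  energy R G = \sum_(x <- s) `|x|.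
Proof.
rewrite /energy => ->; set p := \prod_(x <- s) _.
have p_neq0 : p != 0 by rewrite monic_neq0 ?monic_prod_XsubC.
rewrite -[RHS]big_undup_iterop_count.
have perm_roots : perm_eq (rootsR p) (undup s).
  apply: uniq_perm; rewrite ?undup_uniq ?uniq_roots //.
  move=> x; rewrite mem_undup -[RHS]root_prod_XsubC.
  by rewrite -(roots_on_rootsR p_neq0) in_itv.
rewrite (perm_big _ perm_roots) /=.
apply: eq_bigr => x _; rewrite mup_prod_XsubC.
by elim: (count _ _) => [|[|k] IHk] //=; rewrite mulrS IHk.
Qed.

End Split.

(** * Characteristic polynomials by computation *)

(** Polynomials are lists of integer coefficients, constant term first, so that
determinants and products of polynomials evaluate by computation; trailing
zeros are allowed. *)
Fixpoint zadd (p q : seq Z) : seq Z :=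
  match p, q with
  | a :: p', b :: q' => (a + b)%BZ :: zadd p' q'
  | [::], _ => q
  | _, [::] => p
  end.

Definition zscale (a : Z) (p : seq Z) : seq Z := [seq (a * b)%BZ | b <- p].

Fixpoint zmul (p q : seq Z) : seq Z :=
  if p is a :: p' then zadd (zscale a q) (0%BZ :: zmul p' q) else [::].

(** Equality up to trailing zeros. *)
Definition zeqp (p q : seq Z) : bool := all (Z.eqb 0) (zadd p (zscale (-1) q)).

(** Laplace expansion along the first row. *)
Fixpoint zdet n (F : nat -> nat -> seq Z) : seq Z :=
  if n is n'.+1 then
    foldr zadd [::]
      [seq zmul (zscale (if odd j then -1 else 1)%BZ (F 0%N j))
                (zdet n' (fun i k => F i.+1 (bump j k))) | j <- iota 0 n]
  else [:: 1%BZ].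

Definition zchar_poly n (a : rel nat) : seq Z :=
  zdet n (fun i j => if i == j then [:: 0%BZ; 1%BZ]
                     else if a i j then [:: (-1)%BZ] else [::]).

Fact ZtoR_key : unit. Proof. by []. Qed.

Section Interpretation.
Variable R : rcfType.

(** Locked, lest unification evaluate large integers in unary. *)
Definition ZtoR (z : Z) : R := locked_with ZtoR_key (int_of_Z z)%:~R.

Lemma ZtoRE z : ZtoR z = (int_of_Z z)%:~R.
Proof. by rewrite /ZtoR unlock. Qed.
Lemma ZtoR0 : ZtoR 0 = 0. Proof. by rewrite ZtoRE. Qed.
Lemma ZtoR1 : ZtoR 1 = 1. Proof. by rewrite ZtoRE. Qed.
Lemma ZtoRN1 : ZtoR (-1) = -1. Proof. by rewrite ZtoRE. Qed.
Lemma ZtoRD a b : ZtoR (a + b) = ZtoR a + ZtoR b.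
Proof. by rewrite !ZtoRE -intrD; congr _%:~R; lia. Qed.
Lemma ZtoRM a b : ZtoR (a * b) = ZtoR a * ZtoR b.
Proof. by rewrite !ZtoRE -intrM; congr _%:~R; lia. Qed.
Lemma ZtoRN a : ZtoR (- a) = - ZtoR a.
Proof. by rewrite !ZtoRE -mulrNz; congr _%:~R; lia. Qed.
Lemma ZtoR_le a b : (ZtoR a <= ZtoR b) = (a <=? b)%BZ.
Proof. by rewrite !ZtoRE ler_int; lia. Qed.
Lemma ZtoR_lt a b : (ZtoR a < ZtoR b) = (a <? b)%BZ.
Proof. by rewrite !ZtoRE ltr_int; lia. Qed.

Definition polyZ (p : seq Z) : {poly R} := Poly (map ZtoR p).

Lemma polyZ_nil : polyZ [::] = 0. Proof. by []. Qed.

Lemma polyZ_cons a p : polyZ (a :: p) = polyZ p * 'X + (ZtoR a)%:P.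
Proof. exact: cons_poly_def. Qed.

Lemma polyZ_add p q : polyZ (zadd p q) = polyZ p + polyZ q.
Proof.
elim: p q => [|a p IHp] [|b q]; rewrite ?polyZ_nil ?(add0r, addr0) //=.
by rewrite !polyZ_cons IHp ZtoRD polyCD mulrDl addrACA.
Qed.

Lemma polyZ_scale a p : polyZ (zscale a p) = (ZtoR a)%:P * polyZ p.
Proof.
elim: p => [|b p IHp]; first by rewrite polyZ_nil mulr0.
by rewrite /= !polyZ_cons IHp ZtoRM polyCM mulrDr mulrA.
Qed.

Lemma polyZ_mul p q : polyZ (zmul p q) = polyZ p * polyZ q.
Proof.
elim: p => [|a p IHp]; first by rewrite polyZ_nil mul0r.
by rewrite /= polyZ_add polyZ_scale !polyZ_cons IHp ZtoR0 addr0 mulrDl addrC mulrAC.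
Qed.

Lemma polyZ_eq p q : zeqp p q -> polyZ p = polyZ q.
Proof.
rewrite /zeqp => /allP eq0; apply/eqP; rewrite -subr_eq0; apply/eqP.
have <-: polyZ (zadd p (zscale (-1) q)) = polyZ p - polyZ q.
  by rewrite polyZ_add polyZ_scale ZtoRN1 polyCN mulN1r.
elim: (zadd _ _) eq0 => [|a r IHr] // eq0; rewrite polyZ_cons IHr.
  have/eq0/Z.eqb_eq <- : a \in a :: r by rewrite mem_head.
  by rewrite mul0r ZtoR0 addr0.
by move=> b rb; apply: eq0; rewrite inE rb orbT.
Qed.

Lemma polyZ_det n F : polyZ (zdet n F) = \det (\matrix_(i < n, j < n) polyZ (F i j)).
Proof.
elim: n F => [|n IHn] F.
  by rewrite det_mx00 polyZ_cons polyZ_nil mul0r add0r ZtoR1.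
rewrite (expand_det_row _ ord0).
transitivity (\sum_(j <- iota 0 n.+1) ((-1) ^+ j * polyZ (F 0%N j) *
     polyZ (zdet n (fun i k => F i.+1 (bump j k))))).
  rewrite /zdet -/zdet; elim: (iota _ _) => [|j s IHs]; first by rewrite big_nil.
  rewrite big_cons /= polyZ_add IHs polyZ_mul polyZ_scale -signr_odd.
  by case: (odd j); rewrite ?ZtoRN1 ?ZtoR1 ?polyCN ?polyC1.
rewrite -[iota _ _]/(index_iota 0 n.+1) big_mkord; apply: eq_bigr => j _.
rewrite !mxE /cofactor add0n IHn -mulrA mulrCA.
congr (_ * (_ * \det _)); apply/matrixP=> i k; rewrite !mxE.
by congr (polyZ (F _ _)).
Qed.

Lemma char_poly_polyZ n (G : sgraph n) (a : rel nat) :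
  (forall i j : 'I_n, G i j = a i j) ->
  char_poly (adjmx R G) = polyZ (zchar_poly n a).
Proof.
move=> Ga; rewrite polyZ_det; congr (\det _); apply/matrixP=> i j.
rewrite !mxE -val_eqE /=; case: eqVneq => [/val_inj<-|_].
  by rewrite adj_irr !polyZ_cons polyZ_nil mul0r add0r ZtoR1 ZtoR0 mul1r addr0 subr0.
rewrite Ga; case: (a i j); rewrite ?polyZ_cons polyZ_nil sub0r ?oppr0 //.
by rewrite mul0r add0r ZtoRN1 polyCN.
Qed.

End Interpretation.

(** * Isolating the roots of integer polynomials *)

(** Eigenvalues are located to within a ten-thousandth. The local energies are
then enclosed in intervals of length at most 0.004, while two distinct local
energies on five vertices differ by at least 0.0068. *)
Definition den : Z := 10000%BZ.

(** The value of [p] at [a / den], multiplied by [den] to the power [size p - 1]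
to clear denominators: this keeps the sign. *)
Fixpoint scaled_eval (p : seq Z) (a : Z) : Z :=
  if p is c :: p' then
    (c * Z.pow den (Z.of_nat (size p')) + a * scaled_eval p' a)%BZ
  else 0%BZ.

(** The interval of numbers [x] such that [x * den] lies between the two bounds. *)
Definition box : Type := (Z * Z)%type.

(** A polynomial with one box for each of its roots. *)
Definition factor : Type := (seq Z * seq box)%type.

(** A monic polynomial with as many disjoint boxes as its degree, and opposite
signs or a zero at the ends of each of them, has exactly one simple root in each box.
Multiple roots are handled by repeating factors. *)
Definition isolates (f : factor) : bool :=
  [&& last 0%BZ f.1 == 1%BZ, size f.1 == (size f.2).+1,
      all (fun b => (b.1 <=? b.2)%BZ &&
             (scaled_eval f.1 b.1 * scaled_eval f.1 b.2 <=? 0)%BZ) f.2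
    & sorted (fun b c : box => (b.2 <? c.1)%BZ) f.2].

Definition zprod (fs : seq factor) : seq Z := foldr zmul [:: 1%BZ] (map fst fs).

(** Bounds on a sum of absolute values, |x| being the maximum of 0, x and -x. *)
Definition abs_sum (bs : seq box) : box :=
  (foldr Z.add 0%BZ [seq Z.max 0 (Z.max b.1 (- b.2)) | b <- bs],
   foldr Z.add 0%BZ [seq Z.max (- b.1) b.2 | b <- bs]).

Section Isolation.
Variable R : rcfType.
Local Notation ZtoR := (ZtoR R).
Local Notation polyZ := (polyZ R).

Definition in_box (x : R) (b : box) : bool :=
  ZtoR b.1 <= x * ZtoR den <= ZtoR b.2.

Lemma den_gt0 : 0 < ZtoR den.
Proof. by rewrite -(ZtoR0 R) ZtoR_lt. Qed.

Lemma scaled_evalE p a :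
  ZtoR (scaled_eval p a) * ZtoR den =
  ZtoR den ^+ size p * (polyZ p).[ZtoR a / ZtoR den].
Proof.
have den_neq0 : ZtoR den != 0 by rewrite gt_eqF ?den_gt0.
have ZtoR_pow k : ZtoR (Z.pow den (Z.of_nat k)) = ZtoR den ^+ k.
  elim: k => [|k IHk]; first by rewrite expr0 -ZtoR1.
  by rewrite Nat2Z.inj_succ Z.pow_succ_r ?ZtoRM ?IHk ?exprS //; lia.
elim: p => [|c p IHp]; first by rewrite polyZ_nil horner0 ZtoR0 mul0r mulr0.
rewrite polyZ_cons !hornerE /= ZtoRD !ZtoRM ZtoR_pow mulrDl -(mulrA (ZtoR a)) IHp.
rewrite exprS; field; exact: den_neq0.
Qed.

(** Intermediate value theorem. *)
Lemma box_root p (b : box) :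
  (b.1 <=? b.2)%BZ -> (scaled_eval p b.1 * scaled_eval p b.2 <=? 0)%BZ ->
  exists2 x : R, in_box x b & root (polyZ p) x.
Proof.
rewrite -(ZtoR_le R) -(ZtoR_le R (_ * _)%BZ) ZtoRM ZtoR0 => le_b sgn.
have d0 := den_gt0.
have [||x x_b px] := @polyrcf.poly_ivt R (polyZ p) (ZtoR b.1 / ZtoR den) (ZtoR b.2 / ZtoR den).
- by rewrite ler_pM2r ?invr_gt0.
- have dn0 : 0 < ZtoR den ^+ size p * ZtoR den ^+ size p.
    by rewrite mulr_gt0 ?exprn_gt0.
  rewrite -(pmulr_rle0 _ dn0) mulrACA -!scaled_evalE mulrACA.
  by rewrite pmulr_lle0 // mulr_gt0.
exists x => //; move: x_b.
by rewrite in_itv /= ler_pdivrMr // ler_pdivlMr.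
Qed.

Lemma sorted_boxes (t : seq (R * box)) :
  all (fun u => in_box u.1 u.2) t ->
  sorted (fun b c : box => (b.2 <? c.1)%BZ) (map snd t) ->
  sorted <%R (map fst t).
Proof.
case: t => [|u t] //=; elim: t u => [|v t IHt] u //= /and3P[u_in v_in t_in].
case/andP=> uv t_sorted; rewrite IHt ?v_in // andbT.
move: u_in v_in => /andP[_ le_u] /andP[le_v _].
rewrite -(ltr_pM2r den_gt0); apply: le_lt_trans le_u _.
by apply: lt_le_trans le_v; rewrite ZtoR_lt.
Qed.

(** The boxes provide as many distinct roots as the degree, so they are all the
roots, and simple. *)
Lemma isolates_split (f : factor) : isolates f ->
  exists t : seq (R * box),
    [/\ polyZ f.1 = \prod_(u <- t) ('X - u.1%:P), map snd t = f.2
      & all (fun u => in_box u.1 u.2) t].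
Proof.
case: f => p bs /and4P[/= /eqP monic_p /eqP size_p boxes_p sorted_bs].
have [t [t_bs t_in t_root]] : exists t : seq (R * box),
    [/\ map snd t = bs, all (fun u => in_box u.1 u.2) t
      & all (root (polyZ p)) (map fst t)].
  elim: bs boxes_p {size_p sorted_bs} => [|b bs IHbs] /=; first by exists [::].
  case/andP=> /andP[le_b sgn_b] /IHbs[t [<- t_in t_root]].
  have [x x_b x_root] := box_root le_b sgn_b.
  by exists ((x, b) :: t); rewrite /= x_b x_root.
exists t; split=> //.
have polyseq_p : polyZ p = map ZtoR p :> seq R.
  by apply: (@PolyK _ (ZtoR 0)); rewrite last_map monic_p ZtoR1 oner_eq0.
have lead_p : lead_coef (polyZ p) = 1.
  by rewrite /lead_coef nth_last polyseq_p -(ZtoR0 R) last_map monic_p ZtoR1.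
rewrite (@all_roots_prod_XsubC _ (polyZ p) (map fst t)) //.
- by rewrite lead_p scale1r big_map.
- by rewrite polyseq_p !size_map size_p -t_bs size_map.
rewrite uniq_rootsE; apply: (sorted_uniq lt_trans ltxx).
by apply: sorted_boxes; rewrite ?t_bs.
Qed.

Lemma zprod_split (fs : seq factor) : all isolates fs ->
  exists t : seq (R * box),
    [/\ polyZ (zprod fs) = \prod_(u <- t) ('X - u.1%:P),
        map snd t = flatten (map snd fs) & all (fun u => in_box u.1 u.2) t].
Proof.
elim: fs => [|f fs IHfs] /=.
  by exists [::]; rewrite big_nil polyZ_cons polyZ_nil mul0r add0r ZtoR1.
case/andP=> /isolates_split[t [f_t t_bs t_in]] /IHfs[t' [fs_t t'_bs t'_in]].
exists (t ++ t'); rewrite map_cat t_bs t'_bs all_cat t_in t'_in.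
by split=> //; rewrite big_cat /= -f_t -fs_t -polyZ_mul.
Qed.

Lemma abs_sum_bounds (t : seq (R * box)) :
  all (fun u => in_box u.1 u.2) t ->
  in_box (\sum_(u <- t) `|u.1|) (abs_sum (map snd t)).
Proof.
elim: t => [|[x b] t IHt]; first by rewrite big_nil /in_box mul0r ZtoR0 lexx.
rewrite /= big_cons => /andP[/andP[/= lo_x hi_x] /IHt/andP[/= lo_t hi_t]].
have abs_x : `|x| * ZtoR den = `|x * ZtoR den|.
  by rewrite normrM (gtr0_norm den_gt0).
rewrite /in_box /= mulrDl abs_x !ZtoRD.
apply/andP; split; apply: lerD => //.
  case: (Z.max_spec 0 (Z.max b.1 (- b.2))) => -[_ ->]; last by rewrite ZtoR0.
  case: (Z.max_spec b.1 (- b.2)) => -[_ ->].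
    by rewrite ZtoRN -normrN (le_trans _ (ler_norm _)) // lerN2.
  by rewrite (le_trans lo_x) ?ler_norm.
have le_max1 : ZtoR (- b.1) <= ZtoR (Z.max (- b.1) b.2) by rewrite ZtoR_le; lia.
have le_max2 : ZtoR b.2 <= ZtoR (Z.max (- b.1) b.2) by rewrite ZtoR_le; lia.
rewrite ler_norml (le_trans hi_x) // andbT lerNl (le_trans _ le_max1) //.
by rewrite ZtoRN lerN2.
Qed.

Lemma energy_bounds n (G : sgraph n) (a : rel nat) (fs : seq factor) :
  (forall i j : 'I_n, G i j = a i j) -> zeqp (zchar_poly n a) (zprod fs) ->
  all isolates fs -> in_box (energy R G) (abs_sum (flatten (map snd fs))).
Proof.
move=> Ga eq_p /zprod_split[t [p_t <- t_in]].
rewrite (@energy_prod _ _ _ (map fst t)) ?big_map ?abs_sum_bounds //.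
by rewrite (char_poly_polyZ R Ga) (polyZ_eq _ eq_p) p_t.
Qed.

End Isolation.

(** * Enclosures of local energies *)

Definition integral_root (k : Z) : factor :=
  ([:: (- k)%BZ; 1%BZ], [:: ((k * den)%BZ, (k * den)%BZ)]).

Definition bracketed (f : seq Z * seq Z) : factor :=
  (f.1, [seq (a, (a + 1)%BZ) | a <- f.2]).

(** One line for each characteristic polynomial of a graph of order 5 and of its
vertex-deleted subgraphs: the integer eigenvalues with multiplicity, then the
remaining factors, each with the integer parts of its roots times [den].
Nothing here is taken on trust: each line is verified by [spectra_isolated],
and a line is only used after comparing its product with the characteristic
polynomial at hand. *)
Definition spectra : seq (seq Z * seq (seq Z * seq Z)) := (
[::
  ([:: -1; -1; -1; 3], [::]);
  ([:: -1; 0], [:: ([:: -4; -1; 1], [:: -15616; 25615])]);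
  ([:: -1], [:: ([:: 1; -3; -1; 1], [:: -14812; 3111; 21700])]);
  ([:: -2; 0; 0; 2], [::]);
  ([:: -1; -1; 0; 2], [::]);
  ([:: 0; 0], [:: ([:: -3; 0; 1], [:: -17321; 17320])]);
  ([::], [:: ([:: 1; 0; -3; 0; 1], [:: -16181; -6181; 6180; 16180])]);
  ([:: 0; 0], [:: ([:: -2; 0; 1], [:: -14143; 14142])]);
  ([:: -1; -1; 1; 1], [::]);
  ([:: -1; 0; 0; 1], [::]);
  ([:: 0; 0; 0; 0], [::]);
  ([:: -1; -1; -1; -1; 4], [::]);
  ([:: -1; -1; 0], [:: ([:: -6; -2; 1], [:: -16458; 36457])]);
  ([:: -1; -1], [:: ([:: 2; -5; -2; 1], [:: -16814; 3579; 33234])]);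
  ([:: -2; 0; 0], [:: ([:: -4; -2; 1], [:: -12361; 32360])]);
  ([:: -1; -1], [:: ([:: 2; -4; -2; 1], [:: -15142; 4280; 30861])]);
  ([:: -2; -1; 0; 0; 3], [::]);
  ([::], [:: ([:: 2; 3; -6; -7; 0; 1], [:: -16181; -14729; -4626; 6180; 29354])]);
  ([:: -1; 0], [:: ([:: 2; -6; -1; 1], [:: -21775; 3216; 28557])]);
  ([:: -1; -1; -1; 0; 3], [::]);
  ([:: 0], [:: ([:: 2; -4; -6; 0; 1], [:: -17492; -12714; 3349; 26855])]);
  ([:: -1], [:: ([:: 2; 1; -5; -1; 1], [:: -17758; -5893; 7237; 26411])]);
  ([:: -1; -1; 1], [:: ([:: -4; -1; 1], [:: -15616; 25615])]);
  ([:: -2; 0], [:: ([:: 2; -2; -2; 1], [:: -11701; 6888; 24811])]);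
  ([:: 0; 0; 0], [:: ([:: -6; 0; 1], [:: -24495; 24494])]);
  ([:: -1; 0; 0], [:: ([:: -4; -1; 1], [:: -15616; 25615])]);
  ([:: -1; 0], [:: ([:: 2; -4; -1; 1], [:: -18137; 4706; 23429])]);
  ([:: 0], [:: ([:: 3; -2; -5; 0; 1], [:: -16181; -13028; 6180; 23027])]);
  ([:: -1; 1], [:: ([:: -2; -4; 0; 1], [:: -16752; -5392; 22143])]);
  ([:: 0], [:: ([:: 2; 0; -5; 0; 1], [:: -21358; -6622; 6621; 21357])]);
  ([:: 2], [:: ([:: -1; 1; 1], [:: -16181; 6180]); ([:: -1; 1; 1], [:: -16181; 6180])]);
  ([:: -1; 0], [:: ([:: 1; -3; -1; 1], [:: -14812; 3111; 21700])]);
  ([:: -1; -1; -1; 1; 2], [::]);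
  ([:: -2; 0; 0; 0; 2], [::]);
  ([:: 0], [:: ([:: 2; 0; -4; 0; 1], [:: -18478; -7654; 7653; 18477])]);
  ([:: -1; 0; 1], [:: ([:: -3; 0; 1], [:: -17321; 17320])]);
  ([:: -1; -1; 0; 0; 2], [::]);
  ([:: 0; 0; 0], [:: ([:: -3; 0; 1], [:: -17321; 17320])]);
  ([:: 0], [:: ([:: 1; 0; -3; 0; 1], [:: -16181; -6181; 6180; 16180])]);
  ([:: -1; 0; 1], [:: ([:: -2; 0; 1], [:: -14143; 14142])]);
  ([:: 0; 0; 0], [:: ([:: -2; 0; 1], [:: -14143; 14142])]);
  ([:: -1; -1; 0; 1; 1], [::]);
  ([:: -1; 0; 0; 0; 1], [::]);
  ([:: 0; 0; 0; 0; 0], [::])])%BZ.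

Definition factors (r : seq Z * seq (seq Z * seq Z)) : seq factor :=
  map integral_root r.1 ++ map bracketed r.2.

Definition enclosures : seq (seq Z * box) :=
  [seq (zprod fs, abs_sum (flatten (map snd fs))) | fs <- map factors spectra].

(** Meaningful only for the polynomials [p] such that [enclosed p]. *)
Definition energy_box (p : seq Z) : box :=
  (nth ([::], (0%BZ, 0%BZ)) enclosures (find (fun e => zeqp p e.1) enclosures)).2.

Definition enclosed (p : seq Z) : bool := has (fun e => zeqp p e.1) enclosures.

Definition minor_rel (a : rel nat) (v : nat) : rel nat :=
  fun i j => a (bump v i) (bump v j).

Definition local_box n (a : rel nat) : box :=
  let e := energy_box (zchar_poly n a) in
  let es := [seq energy_box (zchar_poly n.-1 (minor_rel a v)) | v <- iota 0 n] in
  ((Z.of_nat n * e.1 - foldr Z.add 0 (map snd es))%BZ,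
   (Z.of_nat n * e.2 - foldr Z.add 0 (map fst es))%BZ).

Definition local_enclosed n (a : rel nat) : bool :=
  enclosed (zchar_poly n a) &&
  all (fun v => enclosed (zchar_poly n.-1 (minor_rel a v))) (iota 0 n).

Definition apart (b c : box) : bool := (b.2 <? c.1)%BZ || (c.2 <? b.1)%BZ.

Lemma spectra_isolated : all (fun r => all isolates (factors r)) spectra.
Proof. by vm_compute. Qed.

Section LocalBounds.
Variable R : rcfType.
Local Notation ZtoR := (ZtoR R).

(** The line of [spectra] that was found has the characteristic polynomial of [G]
as its product. *)
Lemma energy_box_bounds n (G : sgraph n) (a : rel nat) :
  (forall i j : 'I_n, G i j = a i j) -> enclosed (zchar_poly n a) ->
  in_box (energy R G) (energy_box (zchar_poly n a)).
Proof.
rewrite /enclosed /energy_box; set p := zchar_poly n a => Ga in_tbl.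
have lt_find := in_tbl; rewrite has_find in lt_find.
have /= := nth_find ([::], (0%BZ, 0%BZ)) in_tbl.
move: (mem_nth ([::], (0%BZ, 0%BZ)) lt_find).
case/mapP=> fs /mapP[r r_in ->] -> /= eq_p.
exact: energy_bounds Ga eq_p (allP spectra_isolated r r_in).
Qed.

Lemma ZtoR_sum (s : seq Z) : ZtoR (foldr Z.add 0%BZ s) = \sum_(z <- s) ZtoR z.
Proof.
elim: s => [|z s IHs]; first by rewrite big_nil ZtoR0.
by rewrite big_cons /= ZtoRD IHs.
Qed.

Lemma ZtoR_nat n : ZtoR (Z.of_nat n) = n%:R.
Proof. by rewrite ZtoRE pmulrn; congr _%:~R; lia. Qed.

Lemma delete_rel n (G : sgraph n) (a : rel nat) (v : 'I_n) :
  (forall i j : 'I_n, G i j = a i j) ->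
  forall i j : 'I_n.-1, delete G v i j = minor_rel a v i j.
Proof. by move=> Ga i j; rewrite !mxE Ga. Qed.

Lemma local_box_bounds n (G : sgraph n) (a : rel nat) :
  (forall i j : 'I_n, G i j = a i j) -> local_enclosed n a ->
  in_box (local_energy R G) (local_box n a).
Proof.
move=> Ga /andP[/(energy_box_bounds Ga)/andP[loG hiG] /allP del_ok].
have del_bounds (v : 'I_n) : in_box (energy R (delete G v))
    (energy_box (zchar_poly n.-1 (minor_rel a v))).
  apply: energy_box_bounds; first exact: delete_rel.
  by apply: (del_ok v); rewrite mem_iota /=.
have sum_iota (F : nat -> Z) :
    ZtoR (foldr Z.add 0%BZ (map F (iota 0 n))) = \sum_(v < n) ZtoR (F v).
  by rewrite ZtoR_sum big_map -(big_mkord predT (ZtoR \o F)) /index_iota subn0.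
rewrite local_energyE /in_box /local_box /= -!map_comp.
rewrite !(ZtoRD, ZtoRM, ZtoRN, ZtoR_nat) !sum_iota mulrBl.
move: (energy R G) loG hiG => E loG hiG.
rewrite -(mulr_natl E) -(mulrA n%:R E) mulr_suml.
apply/andP; split; apply: lerB.
- exact: ler_wpM2l (ler0n R n) _ _ loG.
- by apply: ler_sum => v _; case/andP: (del_bounds v).
- exact: ler_wpM2l (ler0n R n) _ _ hiG.
- by apply: ler_sum => v _; case/andP: (del_bounds v).
Qed.

Lemma apart_neq (x y : R) (b c : box) :
  in_box x b -> in_box y c -> apart b c -> x != y.
Proof.
move=> /andP[lo_x hi_x] /andP[lo_y hi_y]; apply: contraTneq => eq_xy.
rewrite /apart -!(ZtoR_lt R) negb_or -!leNgt.
by rewrite (le_trans lo_y) -?eq_xy // (le_trans lo_x) // eq_xy.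
Qed.

(** Graphs with an integral spectrum have boxes reduced to a point, which give
their energies exactly. *)
Lemma point_box (x : R) (b : box) (z : Z) :
  in_box x b -> b = ((z * den)%BZ, (z * den)%BZ) -> x = ZtoR z.
Proof.
move=> x_b eq_b; move: x_b; rewrite eq_b /in_box /= -eq_le ZtoRM => /eqP/esym.
by move/(mulIf (lt0r_neq0 (den_gt0 R))).
Qed.
End LocalBounds.

(** * Graphs of order five up to isomorphism *)

Definition pairs (n : nat) : seq (nat * nat) :=
  [seq (i, j) | j <- iota 0 n, i <- iota 0 j].

(** The rank of the pair of [i] and [j] in [pairs n], whatever [n]: the pairs
whose larger element is less than [m] come first, and there are m(m-1)/2. *)
Definition pair_index (i j : nat) : nat :=
  let m := maxn i j in ((m * m.-1)./2 + minn i j)%N.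

(** A graph is coded by the list of the truth values of its adjacencies along
[pairs]. *)
Definition code_rel (c : bitseq) : rel nat :=
  fun i j => (i != j) && nth false c (pair_index i j).

Definition code_of (n : nat) (a : rel nat) : bitseq :=
  [seq a e.1 e.2 | e <- pairs n].

Definition edge_code (es : seq (nat * nat)) : bitseq := [seq e \in es | e <- pairs 5].

Definition code_K4K1 := edge_code [:: (0, 1); (0, 2); (1, 2); (0, 3); (1, 3); (2, 3)]%N.
Definition code_K2K2K1 := edge_code [:: (0, 1); (2, 3)]%N.
Definition code_K5 := edge_code (pairs 5).
Definition code_K3K2 := edge_code [:: (0, 1); (0, 2); (1, 2); (3, 4)]%N.
Definition code_C5 := edge_code [:: (0, 1); (1, 2); (2, 3); (0, 4); (3, 4)]%N.

Definition codes8 : seq bitseq := [:: code_K4K1; code_K2K2K1].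
Definition codes10 : seq bitseq := [:: code_K5; code_K3K2; code_C5].

(** The 29 other isomorphism classes, by increasing local energy. *)
Definition other_codes : seq bitseq := map edge_code [::
  [::];
  [:: (0, 1)];
  [:: (0, 1); (0, 2)];
  [:: (0, 2); (1, 2); (0, 3); (1, 3)];
  [:: (0, 1); (0, 2); (0, 3)];
  [:: (0, 2); (1, 2); (0, 3); (1, 3); (0, 4); (1, 4)];
  [:: (0, 1); (0, 2); (1, 2)];
  [:: (0, 1); (0, 2); (0, 3); (0, 4)];
  [:: (0, 1); (0, 2); (1, 2); (0, 3); (1, 3)];
  [:: (0, 1); (0, 2); (1, 2); (0, 3); (1, 3); (0, 4); (1, 4)];
  [:: (0, 1); (0, 2); (0, 3); (1, 3); (2, 3); (0, 4); (1, 4); (2, 4)];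
  [:: (0, 1); (0, 2); (1, 2); (0, 3)];
  [:: (0, 1); (1, 2); (0, 3)];
  [:: (1, 2); (0, 3); (0, 4)];
  [:: (0, 2); (1, 2); (1, 3); (0, 4)];
  [:: (0, 2); (1, 2); (0, 3); (1, 3); (2, 3); (0, 4); (1, 4)];
  [:: (0, 2); (1, 2); (0, 3); (1, 3); (0, 4)];
  [:: (0, 1); (1, 2); (0, 3); (2, 3); (0, 4); (1, 4)];
  [:: (0, 1); (0, 2); (1, 2); (0, 3); (1, 3); (0, 4)];
  [:: (0, 1); (1, 2); (0, 3); (0, 4)];
  [:: (0, 1); (0, 2); (1, 2); (0, 3); (1, 3); (2, 3); (0, 4); (1, 4); (2, 4)];
  [:: (0, 1); (0, 2); (1, 2); (1, 3); (0, 4)];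
  [:: (0, 1); (0, 2); (1, 2); (0, 3); (0, 4)];
  [:: (0, 1); (1, 2); (1, 3); (2, 3); (0, 4)];
  [:: (0, 1); (0, 2); (1, 2); (0, 3); (1, 3); (2, 3); (0, 4)];
  [:: (0, 1); (0, 2); (1, 2); (1, 3); (2, 3); (0, 4)];
  [:: (0, 1); (0, 2); (1, 2); (0, 3); (1, 3); (2, 3); (0, 4); (1, 4)];
  [:: (0, 1); (0, 2); (1, 2); (0, 3); (2, 3); (0, 4); (1, 4)];
  [:: (0, 1); (0, 2); (0, 3); (2, 3); (0, 4); (1, 4)]]%N.

Definition representatives : seq bitseq := codes8 ++ codes10 ++ other_codes.

(** Where the bits of a code come from when its vertices are relabelled by [t].
This list is computed once for each of the 120 permutations rather than once
for each graph. *)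
Definition positions (t : seq nat) : seq nat :=
  [seq pair_index (nth 0%N t e.1) (nth 0%N t e.2) | e <- pairs 5].

Definition relabel (ks : seq nat) (c : bitseq) : bitseq :=
  [seq nth false c k | k <- ks].

Fixpoint bitseqs (n : nat) : seq bitseq :=
  if n is n'.+1 then
    map (cons false) (bitseqs n') ++ map (cons true) (bitseqs n')
  else [:: [::]].

Definition grouped (c d : bitseq) : bool :=
  [|| c == d, (c \in codes8) && (d \in codes8)
    | (c \in codes10) && (d \in codes10)].

Lemma pair_indexC : commutative pair_index.
Proof. by move=> i j; rewrite /pair_index maxnC minnC. Qed.

Lemma code_rel_sym c : symmetric (code_rel c).
Proof. by move=> i j; rewrite /code_rel eq_sym pair_indexC. Qed.

Fact code_graph_subproof n c (A := \matrix_(i < n, j < n) code_rel c i j) :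
  (A^T == A) && [forall i, ~~ A i i].
Proof.
by apply: adj_intro => [i j|i]; rewrite !mxE ?(code_rel_sym c i) // /code_rel eqxx.
Qed.

Definition code_graph n (c : bitseq) : sgraph n := SGraph (code_graph_subproof n c).

Lemma code_graphE n c (i j : 'I_n) : code_graph n c i j = code_rel c i j.
Proof. exact: mxE. Qed.

Lemma nth_pairs i j : (i < 5)%N -> (j < 5)%N -> i != j ->
  (pair_index i j < size (pairs 5))%N /\
  nth (0%N, 0%N) (pairs 5) (pair_index i j) = (minn i j, maxn i j).
Proof. by case: i => [|[|[|[|[|]]]]]; case: j => [|[|[|[|[|]]]]]. Qed.

Lemma code_rel_of a i j : symmetric a -> (i < 5)%N -> (j < 5)%N ->
  code_rel (code_of 5 a) i j = (i != j) && a i j.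
Proof.
move=> sym_a lt_i lt_j; rewrite /code_rel; case: (eqVneq i j) => //= ij.
have [lt_ij nth_ij] := nth_pairs lt_i lt_j ij.
rewrite (nth_map (0%N, 0%N)) // nth_ij /=.
by case: (leqP i j).
Qed.

Lemma sgraph_code (G : sgraph 5) : G = code_graph 5 (code_of 5 (fun i j => G (inord i) (inord j))).
Proof.
apply: sgraph_eq => i j; rewrite code_graphE code_rel_of //.
  rewrite !inord_val; case: (eqVneq (i : nat) j) => //= /val_inj->.
  exact: adj_irr.
by move=> k l; apply: adj_sym.
Qed.

Lemma relabelE t c : relabel (positions t) c =
  code_of 5 (fun i j => nth false c (pair_index (nth 0%N t i) (nth 0%N t j))).
Proof. by rewrite /relabel -map_comp. Qed.

(** Relabelled codes are codes of isomorphic graphs, so that searching for an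
isomorphism is a search among lists of bits. *)
Lemma relabel_iso t c : perm_eq t (iota 0 5) ->
  iso (code_graph 5 (relabel (positions t) c)) (code_graph 5 c).
Proof.
move=> perm_t; have size_t : size t = 5 by rewrite (perm_size perm_t) size_iota.
have lt_t (i : 'I_5) : (nth 0%N t i < 5)%N.
  have: nth 0%N t i \in iota 0 5 by rewrite -(perm_mem perm_t) mem_nth ?size_t.
  by rewrite mem_iota.
have inj_s : injective (fun i : 'I_5 => Ordinal (lt_t i)).
  move=> i j [] /eqP; rewrite nth_uniq ?size_t //; first by move/eqP/val_inj.
  by rewrite (perm_uniq perm_t) iota_uniq.
apply/isoP; exists (perm inj_s) => i j.
rewrite !code_graphE relabelE code_rel_of //; last by move=> k l; rewrite pair_indexC.
by rewrite /code_rel !val_eqE (inj_eq perm_inj) !permE.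
Qed.

Lemma mem_bitseqs c : c \in bitseqs (size c).
Proof.
elim: c => [|[] c IHc] //=; rewrite mem_cat !mem_map ?IHc ?orbT //; by move=> ? ? [].
Qed.

(** The local definitions make the evaluation share both lists between the 1024
labelled graphs. *)
Lemma code_search : let ps := map positions (permutations (iota 0 5)) in
  let rs := representatives in
  all (fun c => has (fun p => relabel p c \in rs) ps) (bitseqs 10).
Proof. by vm_compute. Qed.

Lemma representative (G : sgraph 5) :
  exists2 c, c \in representatives & iso (code_graph 5 c) G.
Proof.
rewrite (sgraph_code G); set c := code_of _ _.
have /(allP code_search)/hasP[_ /mapP[t t_perm ->] rep_t] : c \in bitseqs 10.
  by have := mem_bitseqs c; rewrite size_map.
exists (relabel (positions t) c) => //; apply: relabel_iso.
by rewrite mem_permutations in t_perm.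
Qed.

(** * Separation of the local energies *)

Lemma representatives_enclosed :
  all (fun c => local_enclosed 5 (code_rel c)) representatives.
Proof. by vm_compute. Qed.

Lemma representatives_apart :
  let bs := [seq (c, local_box 5 (code_rel c)) | c <- representatives] in
  all (fun x => all (fun y => grouped x.1 y.1 || apart x.2 y.2) bs) bs.
Proof. by vm_compute. Qed.

Section Separation.
Variable R : rcfType.

Lemma representative_bounds c : c \in representatives ->
  in_box (local_energy R (code_graph 5 c)) (local_box 5 (code_rel c)).
Proof.
move=> c_in; apply: local_box_bounds; first exact: code_graphE.
exact: allP representatives_enclosed c c_in.
Qed.

Lemma local_energy_grouped c d : c \in representatives -> d \in representatives ->
  local_energy R (code_graph 5 c) = local_energy R (code_graph 5 d) -> grouped c d.
Proof.
move=> c_in d_in eq_cd.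
set box_of := fun c => (c, local_box 5 (code_rel c)).
have := allP (allP representatives_apart (box_of c) (map_f _ c_in))
             (box_of d) (map_f _ d_in).
case/orP=> [cd_grouped | cd_apart]; first exact: cd_grouped.
have := apart_neq (representative_bounds c_in) (representative_bounds d_in)
                  cd_apart.
by rewrite eq_cd eqxx.
Qed.

Lemma local_energy8 c : c \in codes8 -> local_energy R (code_graph 5 c) = 8%:R.
Proof.
move=> c_in; rewrite -(ZtoR_nat R 8).
apply: point_box (representative_bounds _) _; first by rewrite mem_cat c_in.
by apply/eqP; move: c c_in; apply/allP; vm_compute.
Qed.

(** Vieta's formulas. *)
Lemma coefs_quadratic (x y : R) (b c : Z) :
  ZtoR R b = - (x + y) -> ZtoR R c = x * y ->
  polyZ R [:: c; b; 1%BZ] = ('X - x%:P) * ('X - y%:P).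
Proof.
move=> sum_xy prod_xy; rewrite !polyZ_cons polyZ_nil sum_xy prod_xy ZtoR1.
rewrite mul0r add0r mul1r polyCN polyCD polyCM.
have quadratic (T : comNzRingType) (z a d : T) :
  (z - (a + d)) * z + a * d = (z - a) * (z - d) by ring.
exact: quadratic.
Qed.

Lemma golden_ratio : exists g : R, g * g = 1 - g.
Proof.
(* The sign of X^2 + X - 1 changes between 0 and 1. *)
have [g _ /rootP g_root] := @box_root R [:: -1; 1; 1]%BZ (0, den)%BZ isT isT.
exists g; move: g_root; rewrite !polyZ_cons polyZ_nil !hornerE ZtoR1 ZtoRN1 => g_root.
by apply/eqP; rewrite -subr_eq0 -g_root; apply/eqP; ring.
Qed.

(** With g a root of X^2 + X - 1, the spectrum of C_5 is 2, and g and -1-g twice.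
Deleting any vertex leaves a path on four vertices, whose spectrum is g, -1-g
and their opposites. The irrational contributions to the two energies agree,
which leaves 5 times 2. *)
Lemma local_energy_C5 : local_energy R (code_graph 5 code_C5) = 10%:R.
Proof.
have [g g_root] := golden_ratio.
have C5_rel := @code_graphE 5 code_C5.
have split_pos : polyZ R [:: -1; 1; 1]%BZ = ('X - g%:P) * ('X - (- 1 - g)%:P).
  apply: coefs_quadratic; rewrite ?ZtoR1 ?ZtoRN1; first by ring.
  by rewrite mulrBr g_root; ring.
have split_neg : polyZ R [:: -1; -1; 1]%BZ = ('X - (- g)%:P) * ('X - (1 + g)%:P).
  apply: coefs_quadratic; rewrite ?ZtoR1 ?ZtoRN1; first by ring.
  by rewrite mulrDr !mulNr g_root; ring.
have energy_C5 : energy R (code_graph 5 code_C5) = 2%:R + (`|g| + `|1 + g|) *+ 2.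
  rewrite (@energy_prod _ _ _ [:: 2%:R; g; - 1 - g; g; - 1 - g]).
    rewrite !big_cons big_nil normr_nat -opprD normrN addr0 mulr2n.
    by rewrite !addrA.
  rewrite (char_poly_polyZ R C5_rel).
  rewrite (@polyZ_eq R _ (zmul [:: -2; 1] (zmul [:: -1; 1; 1] [:: -1; 1; 1]))%BZ) //.
  rewrite !polyZ_mul split_pos !big_cons big_nil mulr1 !mulrA.
  do 4 congr (_ * _).
  rewrite !polyZ_cons polyZ_nil ZtoR1 mul0r add0r mul1r.
  by rewrite (ZtoRN R 2) (ZtoR_nat R 2) polyCN.
have energy_P4 (v : 'I_5) :
    energy R (delete (code_graph 5 code_C5) v) = (`|g| + `|1 + g|) *+ 2.
  rewrite (@energy_prod _ _ _ [:: g; - 1 - g; - g; 1 + g]).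
    by rewrite !big_cons big_nil -opprD !normrN addr0 mulr2n !addrA.
  rewrite (char_poly_polyZ R (delete_rel v C5_rel)).
  rewrite (@polyZ_eq R _ (zmul [:: -1; 1; 1] [:: -1; -1; 1])%BZ).
    by rewrite polyZ_mul split_pos split_neg !big_cons big_nil mulr1 !mulrA.
  by case: v => [[|[|[|[|[|]]]]]].
rewrite local_energyE energy_C5 (eq_bigr _ (fun v _ => energy_P4 v)).
by rewrite sumr_const card_ord mulrnDl addrK -mulrnA.
Qed.

Lemma local_energy10 c : c \in codes10 -> local_energy R (code_graph 5 c) = 10%:R.
Proof.
rewrite inE [c \in _]inE orbA => /orP[c_in|].
  rewrite -(ZtoR_nat R 10).
  have c_rep : c \in representatives by case/orP: c_in => /eqP->.
  apply: point_box (representative_bounds c_rep) _.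
  by case/orP: c_in => /eqP->; apply/eqP; vm_compute.
by rewrite inE => /eqP->; apply: local_energy_C5.
Qed.

End Separation.

(** * The graphs of the two classes *)

Definition sum_rel (m : nat) (a b : rel nat) : rel nat := fun i j =>
  if (i < m)%N then (j < m)%N && a i j else (m <= j)%N && b (i - m)%N (j - m)%N.

Lemma disjoint_union_rel m n (G : sgraph m) (H : sgraph n) (a b : rel nat) :
  (forall i j : 'I_m, G i j = a i j) -> (forall i j : 'I_n, H i j = b i j) ->
  forall i j : 'I_(m + n), disjoint_union G H i j = sum_rel m a b i j.
Proof.
move=> Ga Hb i j; rewrite /sum_rel /=.
case: (split_ordP i) => k ->; case: (split_ordP j) => l ->;
  rewrite ?(block_mxEul, block_mxEur, block_mxEdl, block_mxEdr) /=;
  rewrite ?ltn_ord ?(ltnNge (m + _)) ?leq_addr ?[(m <= l)%N]leqNgt ?ltn_ord /= ?mxE //.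
by rewrite Hb !addKn.
Qed.

Definition neq_rel : rel nat := fun i j => i != j.

Definition cycle_rel (n : nat) : rel nat :=
  fun i j => (i != j) && ((j == i.+1 %% n)%N || (i == j.+1 %% n)%N).

Lemma complete_rel n (i j : 'I_n) : complete n i j = neq_rel i j.
Proof. exact: mxE. Qed.

Lemma cycle_graph_rel n (i j : 'I_n) : cycle_graph n i j = cycle_rel n i j.
Proof. exact: mxE. Qed.

Lemma code_graph_eq (G : sgraph 5) (a : rel nat) (c : bitseq) :
  (forall i j : 'I_5, G i j = a i j) ->
  all (fun i => all (fun j => a i j == code_rel c i j) (iota 0 5)) (iota 0 5) ->
  G = code_graph 5 c.
Proof.
move=> Ga eq_ac; apply: sgraph_eq => i j; rewrite code_graphE Ga.
have in_iota (k : 'I_5) : (k : nat) \in iota 0 5 by rewrite mem_iota /=.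
by apply/eqP; apply: (allP (allP eq_ac i (in_iota i)) j (in_iota j)).
Qed.

Lemma K5_code : complete 5 = code_graph 5 code_K5.
Proof. by apply: code_graph_eq; first exact: complete_rel. Qed.

Lemma C5_code : cycle_graph 5 = code_graph 5 code_C5.
Proof. by apply: code_graph_eq; first exact: cycle_graph_rel. Qed.

Lemma K3K2_code :
  disjoint_union (complete 3) (complete 2) = code_graph 5 code_K3K2.
Proof.
by apply: code_graph_eq; first exact: disjoint_union_rel (@complete_rel 3) (@complete_rel 2).
Qed.

Lemma K4K1_code :
  disjoint_union (complete 4) (complete 1) = code_graph 5 code_K4K1.
Proof.
by apply: code_graph_eq; first exact: disjoint_union_rel (@complete_rel 4) (@complete_rel 1).
Qed.

Lemma K2K2K1_code :
  disjoint_union (disjoint_union (complete 2) (complete 2)) (complete 1) =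
  code_graph 5 code_K2K2K1.
Proof.
by apply: code_graph_eq; first exact: disjoint_union_rel
  (disjoint_union_rel (@complete_rel 2) (@complete_rel 2)) (@complete_rel 1).
Qed.

(** * The classes of locally equienergetic graphs *)

Section Classes.
Variable R : rcfType.

Definition code_class (c : bitseq) : {set sgraph 5} := iso_class (code_graph 5 c).

(** Isomorphic graphs have the same energy, so disjoint enclosures of the energies
show that two graphs are not isomorphic even when their local energies agree. *)
Lemma code_class_neq c d :
  enclosed (zchar_poly 5 (code_rel c)) -> enclosed (zchar_poly 5 (code_rel d)) ->
  apart (energy_box (zchar_poly 5 (code_rel c)))
        (energy_box (zchar_poly 5 (code_rel d))) ->
  code_class c != code_class d.
Proof.
move=> c_in d_in cd_apart; rewrite iso_class_eq; apply/negP=> /(iso_energy R)/eqP.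
apply/negP; apply: apart_neq cd_apart; apply: energy_box_bounds => //;
  exact: code_graphE.
Qed.

Lemma grouped_codes8 c d : grouped c d -> c \in codes8 -> d \in codes8.
Proof.
case/or3P=> [/eqP-> | /andP[] | /andP[c10 _]] // c8; move: c10.
by apply: contraTT => _; move: c c8; apply/allP; vm_compute.
Qed.

Lemma grouped_codes10 c d : grouped c d -> c \in codes10 -> d \in codes10.
Proof.
case/or3P=> [/eqP-> | /andP[c8 _] | /andP[]] // c10; move: c8.
by apply: contraTT => _; move: c c10; apply/allP; vm_compute.
Qed.

(** A graph of local energy [t] has a representative grouped with [c0], because
[c0] has the same local energy; this representative is then in [cs]. *)
Lemma iso_classes_of_codes (cs : seq bitseq) (c0 : bitseq) (t : R) :
  c0 \in cs -> {subset cs <= representatives} ->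
  (forall c, c \in cs -> local_energy R (code_graph 5 c) = t) ->
  (forall c, grouped c0 c -> c \in cs) ->
  iso_classes_with_local_energy 5 t = [set:: map code_class cs].
Proof.
move=> c0_in cs_rep cs_t cs_grouped; apply/setP=> S; rewrite inE.
apply/imsetP/mapP=> [[G] | [c c_in ->]]; last first.
  by exists (code_graph 5 c); rewrite ?inE ?cs_t.
rewrite inE => /eqP G_t ->; have [c c_rep c_iso] := representative G.
exists c; last by apply/eqP; rewrite iso_class_eq iso_sym.
apply: cs_grouped; apply: (@local_energy_grouped R _ _ (cs_rep c0 c0_in) c_rep).
by rewrite (cs_t c0 c0_in) (iso_local_energy R c_iso).
Qed.

Lemma iso_classes8 :
  iso_classes_with_local_energy 5 (8%:R : R) = [set:: map code_class codes8].
Proof.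
have c_in : code_K4K1 \in codes8 by rewrite mem_head.
apply: (iso_classes_of_codes c_in) => [c c8 | c | c /grouped_codes8->] //.
  by rewrite mem_cat c8.
exact: local_energy8.
Qed.

Lemma iso_classes10 :
  iso_classes_with_local_energy 5 (10%:R : R) = [set:: map code_class codes10].
Proof.
have c_in : code_K5 \in codes10 by rewrite mem_head.
apply: (iso_classes_of_codes c_in) => [c c10 | c | c /grouped_codes10->] //.
  by rewrite !mem_cat c10 orbT.
exact: local_energy10.
Qed.

(** Two non-isomorphic graphs have distinct representatives; if these have the
same local energy, they both belong to one of the two lists. *)
Lemma shared_local_energy (t : R) :
  (1 < #|iso_classes_with_local_energy 5 t|)%N -> t = 8%:R \/ t = 10%:R.
Proof.
case/card_gt1P=> _ [_ [/imsetP[G G_t ->] /imsetP[H H_t ->]]].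
rewrite !inE in G_t H_t; rewrite iso_class_eq => nisoGH.
have [c c_rep isoG] := representative G; have [d d_rep isoH] := representative H.
have eq_c : local_energy R (code_graph 5 c) = t.
  by rewrite (iso_local_energy R isoG) (eqP G_t).
have eq_d : local_energy R (code_graph 5 d) = t.
  by rewrite (iso_local_energy R isoH) (eqP H_t).
have := local_energy_grouped c_rep d_rep (etrans eq_c (esym eq_d)).
case/or3P=> [/eqP eq_cd | /andP[c8 _] | /andP[c10 _]].
- by case/negP: nisoGH; rewrite -eq_cd iso_sym in isoH; rewrite iso_sym (iso_trans isoH).
- by left; rewrite -eq_c local_energy8.
- by right; rewrite -eq_c local_energy10.
Qed.

Lemma K5_neq_K3K2 : code_class code_K5 != code_class code_K3K2.
Proof. by apply: code_class_neq; vm_compute. Qed.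

Lemma K4K1_neq_K2K2K1 : code_class code_K4K1 != code_class code_K2K2K1.
Proof. by apply: code_class_neq; vm_compute. Qed.

Lemma locally_equienergetic_classes5 :
  locally_equienergetic_classes R 5 =
  [set [set:: map code_class codes10]; [set:: map code_class codes8]].
Proof.
apply/setP=> S; rewrite !inE; apply/andP/orP=> [[/imsetP[G _ ->] gt1] | S_in].
  have [->|->] := shared_local_energy gt1; first by rewrite iso_classes8 eqxx; right.
  by rewrite iso_classes10 eqxx; left.
split.
  case: S_in => /eqP->; apply/imsetP.
    exists (code_graph 5 code_K5) => //.
    by rewrite local_energy10 ?mem_head // iso_classes10.
  exists (code_graph 5 code_K4K1) => //.
  by rewrite local_energy8 ?mem_head // iso_classes8.
case: S_in => /eqP->; apply/card_gt1P.
  exists (code_class code_K5), (code_class code_K3K2).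
  split; last exact: K5_neq_K3K2; rewrite inE; apply: map_f.
    exact: mem_head.
  by rewrite inE mem_head orbT.
exists (code_class code_K4K1), (code_class code_K2K2K1).
split; last exact: K4K1_neq_K2K2K1; rewrite inE; apply: map_f.
  exact: mem_head.
by rewrite inE mem_head orbT.
Qed.

Lemma iso_classes_neq :
  [set:: map code_class codes10] != [set:: map code_class codes8].
Proof.
rewrite -iso_classes10 -iso_classes8; apply/eqP=> /setP/(_ (code_class code_K5)).
have -> : code_class code_K5 \in iso_classes_with_local_energy 5 (10%:R : R).
  by rewrite iso_classes10 inE mem_head.
move/esym/imsetP=> [G]; rewrite inE => /eqP G_8 /eqP.
rewrite iso_class_eq => /(iso_local_energy R); rewrite G_8 local_energy10 ?mem_head //.
by move/eqP; rewrite eqr_nat.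
Qed.
End Classes.

Theorem proposition4 (R : rcfType) :
  let K5 : sgraph 5 := complete 5 in
  let K3K2 : sgraph 5 := disjoint_union (complete 3) (complete 2) in
  let C5 : sgraph 5 := cycle_graph 5 in
  let K4K1 : sgraph 5 := disjoint_union (complete 4) (complete 1) in
  let K2K2K1 : sgraph 5 :=
    disjoint_union (disjoint_union (complete 2) (complete 2)) (complete 1) in
  [/\ #|locally_equienergetic_classes R 5| = 2%N,
      locally_equienergetic_classes R 5 =
        [set [set iso_class K5; iso_class K3K2; iso_class C5];
             [set iso_class K4K1; iso_class K2K2K1]],
      local_energy R K5 = local_energy R K3K2
        /\ local_energy R K3K2 = local_energy R C5
    & local_energy R K4K1 = local_energy R K2K2K1].
Proof.
rewrite /= K5_code K3K2_code C5_code K4K1_code K2K2K1_code.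
split.
- by rewrite locally_equienergetic_classes5 cards2 (iso_classes_neq R).
- rewrite locally_equienergetic_classes5; congr [set _; _];
    by apply/setP=> S; rewrite !inE ?orbA.
- by rewrite !local_energy10 ?inE ?eqxx ?orbT.
- by rewrite !local_energy8 ?inE ?eqxx ?orbT.
Qed.
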